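(* Let $\lambda\in(0,1)$ and $T\ge0$. Then $$\|\tilde V^1_\lambda-\tilde V^1_{\lambda,T+1}\|_{\sup}\le(1-\lambda)\|\tilde V^1_\lambda-\tilde V^1_{\lambda,T}\|_{\sup},\qquad \|\tilde V^2_\lambda-\tilde V^2_{\lambda,T+1}\|_{\sup}\le(1-\lambda)\|\tilde V^2_\lambda-\tilde V^2_{\lambda,T}\|_{\sup}.$$
   Context: Setting: nonempty finite type sets $K,L$, action sets $A,B$, payoff $M:K\times L\times A\times B\to\mathbb R$; players choose actions simultaneously each stage, actions are publicly announced, strategies may depend on own type and both action histories. Discounted type-1 dual game $\tilde\Gamma^1_\lambda(\mu,q)$ ($\mu\in\mathbb R^{|K|}$, $q\in\Delta(L)$): player 1 chooses his own type $k$ (by a distribution of his choice, unknown to player 2), nature draws $l\sim q$ and tells only player 2, infinitely many stages are played, and player 1 (maximizer) receives $\mathbb E[\mu^k+\sum_{t\ge1}\lambda(1-\lambda)^{t-1}M(k,l,a_t,b_t)]$; value $\tilde V^1_\lambda(\mu,q)$. Discounted type-2 dual game $\tilde\Gamma^2_\lambda(p,\nu)$ ($p\in\Delta(K)$, $\nu\in\mathbb R^{|L|}$): $k\sim p$ drawn by nature and told to player 1, player 2 chooses $l$ himself, payoff $\mathbb E[\nu^l+\sum_{t\ge1}\lambda(1-\lambda)^{t-1}M]$; value $\tilde V^2_\lambda(p,\nu)$. The truncated versions $\tilde\Gamma^1_{\lambda,T},\tilde\Gamma^2_{\lambda,T}$ are the same games with the sum over $t=1,\dots,T$ only; values $\tilde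 V^1_{\lambda,T}(\mu,q)$, $\tilde V^2_{\lambda,T}(p,\nu)$, with $\tilde V^1_{\lambda,0}(\mu,q)=\max_k\mu^k$ and $\tilde V^2_{\lambda,0}(p,\nu)=\min_l\nu^l$. $\|f\|_{\sup}=\sup_{x}|f(x)|$ over the domain ($\mathbb R^{|K|}\times\Delta(L)$, resp. $\Delta(K)\times\mathbb R^{|L|}$). *)

(* Defs.v *)
From HB Require Import structures.
From mathcomp Require Import all_boot all_order all_algebra.
From mathcomp Require Import all_classical all_reals all_analysis.
Set Implicit Arguments. Unset Strict Implicit. Unset Printing Implicit Defensive.
Import Order.TTheory GRing.Theory Num.Theory numFieldNormedType.Exports.
Local Open Scope ring_scope.
Local Open Scope classical_set_scope.

Section DualGames.
Variables (R : realType) (K L A B : finType).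
Variable M : K -> L -> A -> B -> R.
Variable lam : R.

Definition is_distr (T : finType) (p : {ffun T -> R}) : Prop :=
  (forall x, 0 <= p x) /\ \sum_(x : T) p x = 1.

Definition history := seq (A * B).

Definition strat1 := K -> history -> {ffun A -> R}.
Definition strat2 := L -> history -> {ffun B -> R}.
Definition valid1 (s : strat1) : Prop := forall k h, is_distr (s k h).
Definition valid2 (t : strat2) : Prop := forall l h, is_distr (t l h).

(* expected sum of the discounted stage payoffs
   lam (1-lam)^(t-1) M(k,l,a_t,b_t) over the next n stages,
   given types (k,l) and current public history h (of length t-1) *)
Fixpoint cont_payoff (s : strat1) (t : strat2) (k : K) (l : L)
    (n : nat) (h : history) : R :=
  match n with
  | 0 => 0
  | n.+1 => \sum_(a : A) \sum_(b : B)
      s k h a * t l h b *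
      (lam * (1 - lam) ^+ size h * M k l a b
       + cont_payoff s t k l n (rcons h (a, b)))
  end.

Definition payoffT (T : nat) (s : strat1) (t : strat2) (k : K) (l : L) : R :=
  cont_payoff s t k l T [::].

Definition payoff_inf (s : strat1) (t : strat2) (k : K) (l : L) : R :=
  limn (fun T : nat => payoffT T s t k l).

(* Type-1 dual game: player 1 picks pi in Delta(K) (his type), l ~ q. *)
Definition dual1_payoff (pay : strat1 -> strat2 -> K -> L -> R)
    (mu : {ffun K -> R}) (q : {ffun L -> R})
    (pi : {ffun K -> R}) (s : strat1) (t : strat2) : R :=
  \sum_(k : K) pi k * \sum_(l : L) q l * (mu k + pay s t k l).

(* value (max-min; the game has a value) *)
Definition dual1_value (pay : strat1 -> strat2 -> K -> L -> R)
    (mu : {ffun K -> R}) (q : {ffun L -> R}) : R :=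
  sup [set v | exists pi s, is_distr pi /\ valid1 s /\
        v = inf [set w | exists t, valid2 t /\ w = dual1_payoff pay mu q pi s t]].

(* Type-2 dual game: k ~ p, player 2 picks rho in Delta(L) (his type). *)
Definition dual2_payoff (pay : strat1 -> strat2 -> K -> L -> R)
    (p : {ffun K -> R}) (nu : {ffun L -> R})
    (rho : {ffun L -> R}) (s : strat1) (t : strat2) : R :=
  \sum_(k : K) p k * \sum_(l : L) rho l * (nu l + pay s t k l).

Definition dual2_value (pay : strat1 -> strat2 -> K -> L -> R)
    (p : {ffun K -> R}) (nu : {ffun L -> R}) : R :=
  sup [set v | exists s, valid1 s /\
        v = inf [set w | exists rho t, is_distr rho /\ valid2 t /\
                   w = dual2_payoff pay p nu rho s t]].

Definition V1 := dual1_value payoff_inf.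
Definition V1T (T : nat) := dual1_value (payoffT T).
Definition V2 := dual2_value payoff_inf.
Definition V2T (T : nat) := dual2_value (payoffT T).

Definition supnorm1 (f : {ffun K -> R} -> {ffun L -> R} -> R) : R :=
  sup [set x | exists mu q, is_distr q /\ x = `|f mu q|].
Definition supnorm2 (f : {ffun K -> R} -> {ffun L -> R} -> R) : R :=
  sup [set x | exists p nu, is_distr p /\ x = `|f p nu|].

End DualGames.

(* Main.v *)
Require Import Defs.
From HB Require Import structures.
From mathcomp Require Import all_boot all_order all_algebra.
From mathcomp Require Import all_classical all_reals all_analysis.
From mathcomp Require Import ring lra.
Import Order.TTheory GRing.Theory Num.Theory numFieldNormedType.Exports.
Local Open Scope ring_scope.
Local Open Scope classical_set_scope.

(* For weights p >= 0 on player 1's types, call a vector g in R^L guaranteed at p if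
   a single strategy of player 1 secures at least g l (p-weighted) against every
   type l of player 2 simultaneously; let G(p) be the set of such vectors.  The dual
   values are V2(p, nu) = sup over g in G(p) of min_l (nu l + g l), and
   V1(mu, q) = sup over p in Delta(K), g in G(p) of <mu, p> + <q, g>.  Adding a first
   stage acts on G by an explicit recursion in which p is split as p = sum_a p_a and
   the continuation vectors enter with weight 1 - lam, so the one-sided distance of
   two families G contracts by 1 - lam; payoff_inf is a fixed point of the recursion.
   It remains to see that the sup norm of a difference of values dominates the
   distance of the families G.  For V2, evaluate at nu = - g.  For V1, separate a
   point from the convex cone {(p, g) | g in G(p)}, by a Hahn-Banach argument on the
   sublinear functional measuring the distance to it.  Working with unnormalised p
   makes the convexity of this cone (the mixing of strategies) an immediate induction
   on the number of stages. *)

(** * Supporting functionals of sublinear functions *)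

Section HahnBanach.
Variables (R : realType).

(** Homogeneity is only asked as an inequality for positive scalars; applied to [c^-1] it yields the
    reverse one. *)
Definition sublinear {V : lmodType R} (N : V -> R) : Prop :=
  (forall x y, N (x + y) <= N x + N y) /\
  (forall c x, 0 < c -> N (c *: x) <= c * N x).

Lemma sublinearZ (V : lmodType R) (N : V -> R) c x :
  sublinear N -> 0 < c -> N (c *: x) = c * N x.
Proof.
move=> [_ hom] c0; apply/eqP; rewrite eq_le hom //=.
rewrite -ler_pdivlMl // mulrC.
have := hom c^-1 (c *: x); rewrite invr_gt0 scalerA mulVf ?gt_eqF // scale1r.
by rewrite mulrC; apply.
Qed.

Lemma sublinear0 (V : lmodType R) (N : V -> R) : sublinear N -> N 0 = 0.
Proof.
move=> sN; have := sublinearZ V N 2 0 sN ltac:(by []); rewrite scaler0; lra.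
Qed.

(** One Hahn-Banach step: [N' x] is the infimum over [t >= 0] of [N (x + t *: e) - t * N e], finite
    because subadditivity bounds it below by [- N (- x)]. The choice [t = 1] at [- e] gives the last
    claim, which makes [N'] linear along [e] and keeps its value there equal to [N e]. *)
Lemma sublinear_straighten (V : lmodType R) (N : V -> R) (e : V) :
  sublinear N -> exists N', [/\ sublinear N', forall x, N' x <= N x
    & N' (- e) <= - N e].
Proof.
move=> sN; have [add hom] := sN.
have N0 := sublinear0 _ _ sN.
pose S x : set R := [set y | exists2 t, 0 <= t & y = N (x + t *: e) - t * N e].
have NZ t x : 0 <= t -> N (t *: x) = t * N x.
  rewrite le_eqVlt => /predU1P[<-|t0]; first by rewrite scale0r mul0r.
  exact: sublinearZ.
have Slb x : lbound (S x) (- N (- x)).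
  move=> _ [t t0 ->]; have := add (x + t *: e) (- x).
  rewrite addrAC subrr add0r NZ //; lra.
have Sinf x t : 0 <= t -> inf (S x) <= N (x + t *: e) - t * N e.
  by move=> t0; apply: ge_inf; [exists (- N (- x)); exact: Slb | exists t].
have Sadh x d : 0 < d ->
    exists2 t, 0 <= t & N (x + t *: e) - t * N e < inf (S x) + d.
  move=> d0.
  have hi : has_inf (S x).
    by split; [exists (N (x + 0 *: e) - 0 * N e); exists 0
              | exists (- N (- x)); exact: Slb].
  by have [_ [t t0 ->] lt] := inf_adherent d0 hi; exists t.
exists (fun x => inf (S x)); split.
- split=> [x y|c x c0].
  + apply/ler_addgt0Pr => d d0.
    have d2 : 0 < d / 2 by lra.
    have [t t0 ht] := Sadh x _ d2; have [u u0 hu] := Sadh y _ d2.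
    have := Sinf (x + y) (t + u) (addr_ge0 t0 u0).
    have := add (x + t *: e) (y + u *: e).
    by rewrite addrACA -scalerDl; lra.
  + rewrite -ler_pdivrMl //; apply/ler_addgt0Pr => d d0.
    have [t t0 ht] := Sadh x _ d0.
    have ct0 : 0 <= c * t by rewrite mulr_ge0 // ltW.
    have := Sinf (c *: x) (c * t) ct0.
    rewrite -scalerA -scalerDr sublinearZ // -mulrA -mulrBr.
    rewrite ler_pdivrMl // => h; apply: le_trans h _.
    by rewrite ler_pM2l // ltW.
- by move=> x; have := Sinf x 0 (lexx 0); rewrite scale0r addr0 mul0r subr0.
- have := Sinf (- e) 1 ler01; rewrite scale1r addNr N0; lra.
Qed.

(** Directions straightened earlier stay straight when the function decreases: [N'' (- f) <= N' (-
    f) <= - N' f <= - N'' f]. *)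
Lemma sublinear_straighten_seq (V : lmodType R) (s : seq V) (N : V -> R) :
  sublinear N -> exists N', [/\ sublinear N', forall x, N' x <= N x
    & forall e, e \in s -> N' (- e) <= - N' e].
Proof.
move=> sN; elim: s => [|e s [N' [sN' le ls]]]; first by exists N; split.
have [N'' [sN'' le' ls']] := sublinear_straighten V N' e sN'.
exists N''; split=> // [x|f]; first exact: le_trans (le' x) (le x).
rewrite inE => /predU1P[->|/ls fs]; first by have := le' e; lra.
by have := le' f; have := le' (- f); lra.
Qed.

(** Straightening along [x0] first preserves the value [N x0]; straightening along the basis vectors
    then leaves a linear function, whose coefficients are [w]. *)
Lemma sublinear_support (I : finType) (N : {ffun I -> R^o} -> R)
    (x0 : {ffun I -> R^o}) :
  sublinear N -> exists w : I -> R,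
    (forall x : {ffun I -> R^o}, \sum_i w i * x i <= N x) /\
    N x0 <= \sum_i w i * x0 i.
Proof.
move=> sN.
have [N1 [sN1 le1 N1x0]] := sublinear_straighten _ N x0 sN.
pose e i : {ffun I -> R^o} := [ffun j => (i == j)%:R].
have [N2 [sN2 le2 lin]] := sublinear_straighten_seq _ [seq e i | i <- enum I] N1 sN1.
have le x : N2 x <= N x := le_trans (le2 x) (le1 x).
have N20 := sublinear0 _ _ sN2.
have NZ c i : N2 (c *: e i) <= N2 (e i) * c.
  have ei : e i \in [seq e i | i <- enum I] by rewrite map_f ?mem_enum.
  have [c0|c0|->] := ltrgt0P c; last by rewrite scale0r N20 mulr0.
    by rewrite sublinearZ // mulrC.
  have -> : c *: e i = (- c) *: (- e i) by rewrite scaleNr scalerN opprK.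
  by rewrite sublinearZ ?oppr_gt0 //; have := lin _ ei; nra.
have ub x : N2 x <= \sum_i N2 (e i) * x i.
  have {1}-> : x = \sum_i x i *: e i.
    apply/ffunP => j; rewrite sum_ffunE (bigD1 j) //= big1 ?addr0.
      by rewrite !ffunE eqxx; exact/esym/mulr1.
    by move=> i ij; rewrite !ffunE (negbTE ij); exact: mulr0.
  elim/big_ind2 : _ => [|a a' b b' ha hb|i _]; first by rewrite N20.
  - by apply: le_trans (sN2.1 _ _) _; rewrite lerD.
  - exact: NZ.
have lb (x : {ffun I -> R^o}) : \sum_i N2 (e i) * x i <= - N2 (- x).
  rewrite lerNr; apply: le_trans (ub _) _; rewrite -sumrN ler_sum // => i _.
  by rewrite ffunE mulrN.
exists (N2 \o e); split=> [x|] /=.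
  apply: le_trans (lb x) _; have := sN2.1 x (- x); rewrite subrr N20.
  by have := le x; lra.
by have := ub x0; have := sN2.1 x0 (- x0); rewrite subrr N20; have := le2 (- x0); lra.
Qed.

End HahnBanach.

(** * Averages and geometric convergence *)

Section Distributions.
Set Implicit Arguments.
Unset Strict Implicit.
Variable (R : realType).

Definition dirac_ffun (T : finType) (x : T) : {ffun T -> R} :=
  [ffun y => (y == x)%:R].

Lemma dirac_distr (T : finType) (x : T) : is_distr (dirac_ffun x).
Proof.
split=> [y|]; first by rewrite ffunE ler0n.
rewrite (bigD1 x) //= ffunE eqxx big1 ?addr0 // => y /negbTE yx.
by rewrite ffunE yx.
Qed.

Lemma sum_dirac (T : finType) (x : T) (f : T -> R) :
  \sum_y dirac_ffun x y * f y = f x.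
Proof.
rewrite (bigD1 x) //= ffunE eqxx mul1r big1 ?addr0 // => y /negbTE yx.
by rewrite ffunE yx mul0r.
Qed.

Lemma mean_ge (T : finType) (w : {ffun T -> R}) (f : T -> R) (x : R) :
  is_distr w -> (forall y, x <= f y) -> x <= \sum_y w y * f y.
Proof.
move=> [w0 w1] xf; rewrite -[leLHS]mul1r -w1 mulr_suml ler_sum // => y _.
by rewrite ler_wpM2l.
Qed.

Lemma mean_norm (T : finType) (w : {ffun T -> R}) (f : T -> R) (x : R) :
  is_distr w -> (forall y, `|f y| <= x) -> `|\sum_y w y * f y| <= x.
Proof.
move=> [w0 w1] fx; apply: le_trans (ler_norm_sum _ _ _) _.
rewrite -[leRHS]mul1r -w1 mulr_suml ler_sum // => y _.
by rewrite normrM (ger0_norm (w0 _)) ler_wpM2l.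
Qed.

Lemma mean_cst (T : finType) (w : {ffun T -> R}) (x : R) :
  is_distr w -> \sum_y w y * x = x.
Proof. by move=> [_ w1]; rewrite -mulr_suml w1 mul1r. Qed.

(** The sequences [u n - c * r ^+ n] and [u n + c * r ^+ n] are monotone in opposite directions and
    have the same limit as [u], which they enclose. *)
Lemma geometric_limit (u : nat -> R) (c r : R) :
  0 <= c -> 0 < r < 1 -> (forall n, `|u n.+1 - u n| <= c * (1 - r) * r ^+ n) ->
  forall n, `|limn u - u n| <= c * r ^+ n.
Proof.
move=> c0 /andP[r0 r1] h n.
have nd : nondecreasing_seq (fun n => u n - c * r ^+ n).
  apply/nondecreasing_seqP => m; have := h m; rewrite ler_norml exprS; nra.
have ni : nonincreasing_seq (fun n => u n + c * r ^+ n).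
  apply/nonincreasing_seqP => m; have := h m; rewrite ler_norml exprS; nra.
have cr m : 0 <= c * r ^+ m by rewrite mulr_ge0 // exprn_ge0 // ltW.
have lim0 : (fun n => c * r ^+ n) @ \oo --> (0 : R).
  rewrite -[X in _ --> X](mulr0 c); apply: cvgMr.
  by apply: cvg_expr; rewrite gtr0_norm.
have cv : cvgn (fun n => u n - c * r ^+ n).
  apply: nondecreasing_is_cvgn => //; exists (u 0 + c * r ^+ 0) => _ [m _ <-].
  by have := ni 0%N m (leq0n m); have := cr m; rewrite /=; lra.
have cu : u @ \oo --> limn (fun n => u n - c * r ^+ n).
  have eu : u = (fun n => u n - c * r ^+ n) \+ (fun n => c * r ^+ n).
    by apply/funext => m /=; rewrite subrK.
  by rewrite {1}eu; have := cvgD cv lim0; rewrite addr0; apply.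
have cu' : limn u = limn (fun n => u n - c * r ^+ n) by exact/cvg_lim.
have cv' : (fun n => u n + c * r ^+ n) @ \oo --> limn u.
  by rewrite -[X in _ --> X]addr0; apply: cvgD lim0; rewrite cu'.
rewrite ler_norml; apply/andP; split.
  rewrite cu' -subr_ge0 opprK; have := nondecreasing_cvgn_le nd cv n; lra.
have := nonincreasing_cvgn_ge ni (cvgP _ cv') n.
by rewrite (cvg_lim _ cv') //; lra.
Unshelve. all: by end_near.
Qed.

Lemma le_geometric (c r x y : R) :
  0 < r < 1 -> (forall n, x <= y + c * r ^+ n) -> x <= y.
Proof.
move=> /andP[r0 r1] h.
have lim0 : (fun n => c * r ^+ n) @ \oo --> (0 : R).
  rewrite -[X in _ --> X](mulr0 c); apply: cvgMr.
  by apply: cvg_expr; rewrite gtr0_norm.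
have : (fun n => y + c * r ^+ n) @ \oo --> y.
  by rewrite -[X in _ --> X]addr0; apply: cvgD lim0; exact: cvg_cst.
move/cvgr_to_ge; apply; near=> n; exact: h.
Unshelve. all: by end_near.
Qed.

End Distributions.

(** * Stage recursion for the discounted payoffs *)

Section Payoffs.
Set Implicit Arguments.
Unset Strict Implicit.
Variables (R : realType) (K L A B : finType).
Variables (M : K -> L -> A -> B -> R) (lam c : R).
Hypotheses (lam0 : 0 < lam) (lam1 : lam < 1) (Mc : forall k l a b, `|M k l a b| <= c).

Lemma discount_lt1 : 0 < 1 - lam < 1.
Proof. by rewrite subr_gt0 lam1 ltrBlDl ltrDr. Qed.

Local Notation strat1 := (strat1 R K A B).
Local Notation strat2 := (strat2 R L A B).
Local Notation payoff := (strat1 -> strat2 -> K -> L -> R).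

Definition shift1 (x : A * B) (s : strat1) : strat1 := fun k h => s k (x :: h).
Definition shift2 (x : A * B) (t : strat2) : strat2 := fun l h => t l (x :: h).

Lemma valid_shift1 x s : valid1 s -> valid1 (shift1 x s).
Proof. by move=> vs k h; exact: vs. Qed.

Lemma valid_shift2 x t : valid2 t -> valid2 (shift2 x t).
Proof. by move=> vt l h; exact: vt. Qed.

(** A Shapley-type operator on arbitrary payoff functions, so that truncated and infinite games are
    treated alike. *)
Definition prefix_stage (pay : payoff) : payoff := fun s t k l =>
  \sum_a s k [::] a * \sum_b t l [::] b *
    (lam * M k l a b
     + (1 - lam) * pay (shift1 (a, b) s) (shift2 (a, b) t) k l).

(** The discount factor is read off the length of the history, so removing the first action pair
    releases one factor [1 - lam]. *)
Lemma cont_payoff_shift s t k l n x h :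
  cont_payoff M lam s t k l n (x :: h) =
  (1 - lam) * cont_payoff M lam (shift1 x s) (shift2 x t) k l n h.
Proof.
elim: n h => [|n IH] h /=; first by rewrite mulr0.
rewrite mulr_sumr; apply: eq_bigr => a _.
rewrite mulr_sumr; apply: eq_bigr => b _.
by rewrite IH exprS /shift1 /shift2; ring.
Qed.

Lemma payoffTS n s t k l :
  payoffT M lam n.+1 s t k l = prefix_stage (payoffT M lam n) s t k l.
Proof.
rewrite /payoffT /prefix_stage /=; apply: eq_bigr => a _.
rewrite mulr_sumr; apply: eq_bigr => b _.
by rewrite cont_payoff_shift expr0 mulr1 mulrA.
Qed.

Lemma prefix_stage_diff pay pay' s t k l (x : R) :
  valid1 s -> valid2 t ->
  (forall s t, valid1 s -> valid2 t -> `|pay s t k l - pay' s t k l| <= x) ->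
  `|prefix_stage pay s t k l - prefix_stage pay' s t k l| <= (1 - lam) * x.
Proof.
move=> vs vt h; rewrite /prefix_stage -sumrB.
under eq_bigr => a _ do rewrite -mulrBr -sumrB.
apply: mean_norm => // a; under eq_bigr => b _ do rewrite -mulrBr.
apply: mean_norm => // b.
rewrite opprD addrACA subrr add0r -mulrBr normrM gtr0_norm ?subr_gt0 //.
apply: ler_wpM2l; first by rewrite subr_ge0 ltW.
by apply: h; [exact: valid_shift1|exact: valid_shift2].
Qed.

Lemma payoffT_incr n s t k l : valid1 s -> valid2 t ->
  `|payoffT M lam n.+1 s t k l - payoffT M lam n s t k l|
    <= c * (1 - (1 - lam)) * (1 - lam) ^+ n.
Proof.
elim: n s t => [|n IH] s t vs vt; last first.
  rewrite [payoffT _ _ n.+2 _ _ _ _]payoffTS [payoffT _ _ n.+1 _ _ _ _]payoffTS exprS.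
  rewrite [leRHS](_ : _ = (1 - lam) * (c * (1 - (1 - lam)) * (1 - lam) ^+ n)).
    exact: prefix_stage_diff.
  by ring.
rewrite payoffTS subr0; apply: mean_norm => // a; apply: mean_norm => // b.
rewrite /payoffT /= mulr0 addr0 normrM gtr0_norm // expr0.
rewrite mulr1 (_ : 1 - (1 - lam) = lam); last by ring.
by rewrite mulrC ler_wpM2r ?Mc // ltW.
Qed.

Lemma payoff_inf_close n s t k l : 0 <= c -> valid1 s -> valid2 t ->
  `|payoff_inf M lam s t k l - payoffT M lam n s t k l| <= c * (1 - lam) ^+ n.
Proof.
move=> c0 vs vt; apply: geometric_limit => //; first exact: discount_lt1.
by move=> m; exact: payoffT_incr.
Qed.

(** Both sides are within a multiple of [(1 - lam) ^+ n] of the payoff of the game with [n.+1]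
    stages, for every [n]. *)
Lemma payoff_inf_stage s t k l : 0 <= c -> valid1 s -> valid2 t ->
  payoff_inf M lam s t k l = prefix_stage (payoff_inf M lam) s t k l.
Proof.
move=> c0 vs vt; apply/eqP; rewrite -subr_eq0 -normr_le0.
apply: (@le_geometric _ (c + c) _ _ _ discount_lt1) => n; rewrite add0r.
have h1 := payoff_inf_close n.+1 k l c0 vs vt.
have h2 : `|prefix_stage (payoffT M lam n) s t k l
           - prefix_stage (payoff_inf M lam) s t k l|
         <= (1 - lam) * (c * (1 - lam) ^+ n).
  apply: prefix_stage_diff => // s' t' vs' vt'.
  by rewrite distrC; exact: payoff_inf_close.
rewrite payoffTS exprS in h1.
have := lerD h1 h2; have := ler_distD (prefix_stage (payoffT M lam n) s t k l)
  (payoff_inf M lam s t k l) (prefix_stage (payoff_inf M lam) s t k l).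
have : 0 <= c * (1 - lam) ^+ n by rewrite mulr_ge0 // exprn_ge0 // subr_ge0 ltW.
by have := lam0; have := lam1; nra.
Qed.

Definition bounded_payoff (x : R) (pay : payoff) :=
  forall s t k l, valid1 s -> valid2 t -> `|pay s t k l| <= x.

(** Only the behaviour of the realised type of player 2 matters. *)
Definition typewise (pay : payoff) :=
  forall s t t' k l, (forall h, t l h = t' l h) -> pay s t k l = pay s t' k l.

Lemma payoffT_bounded n : 0 <= c -> bounded_payoff c (payoffT M lam n).
Proof.
move=> c0; elim: n => [|n IH] s t k l vs vt; first by rewrite normr0.
rewrite payoffTS; apply: mean_norm => // a; apply: mean_norm => // b.
apply: le_trans (ler_normD _ _) _.
have {}IH := IH _ _ k l (valid_shift1 (a, b) vs) (valid_shift2 (a, b) vt).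
rewrite !normrM (gtr0_norm lam0) (@gtr0_norm _ (1 - lam)) ?subr_gt0 //.
have h1 := ler_wpM2l (ltW lam0) (Mc k l a b).
have l1 : 0 <= 1 - lam by rewrite subr_ge0 ltW.
by have h2 := ler_wpM2l l1 IH; lra.
Qed.

Lemma payoff_inf_bounded : 0 <= c -> bounded_payoff c (payoff_inf M lam).
Proof.
move=> c0 s t k l vs vt; have := payoff_inf_close 0 k l c0 vs vt.
by rewrite expr0 mulr1 subr0.
Qed.

Lemma payoffT_typewise n : typewise (payoffT M lam n).
Proof.
move=> s t t' k l e; rewrite /payoffT; elim: n [::] => //= n IH h.
apply: eq_bigr => a _; apply: eq_bigr => b _.
by rewrite e IH.
Qed.

Lemma payoff_inf_typewise : typewise (payoff_inf M lam).
Proof.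
move=> s t t' k l e; congr (limn _); apply/funext => n.
exact: payoffT_typewise.
Qed.

End Payoffs.

(** * Vectors guaranteed by player 1 *)

Section Guarantees.
Set Implicit Arguments.
Unset Strict Implicit.
Variables (R : realType) (K L A B : finType).
Variables (M : K -> L -> A -> B -> R) (lam c : R).
Hypotheses (lam0 : 0 < lam) (lam1 : lam < 1).
Variables (a0 : A) (b0 : B).

Local Notation strat1 := (strat1 R K A B).
Local Notation strat2 := (strat2 R L A B).
Local Notation payoff := (strat1 -> strat2 -> K -> L -> R).

Definition guaranteed (pay : payoff) (p : K -> R) (g : L -> R) : Prop :=
  exists s, valid1 s /\
    forall t, valid2 t -> forall l, g l <= \sum_k p k * pay s t k l.

Lemma guaranteed_le pay p g g' :
  (forall l, g' l <= g l) -> guaranteed pay p g -> guaranteed pay p g'.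
Proof.
move=> le [s [vs h]]; exists s; split=> // t vt l.
exact: le_trans (le l) (h t vt l).
Qed.

Lemma guaranteed_scale pay p g (x : R) : 0 <= x -> guaranteed pay p g ->
  guaranteed pay (fun k => x * p k) (fun l => x * g l).
Proof.
move=> x0 [s [vs h]]; exists s; split=> // t vt l.
under eq_bigr => k _ do rewrite -mulrA.
by rewrite -mulr_sumr ler_wpM2l // h.
Qed.

Lemma guaranteed_perturb pay p p' g : bounded_payoff c pay ->
  guaranteed pay p g ->
  guaranteed pay p' (fun l => g l - c * \sum_k `|p k - p' k|).
Proof.
move=> bp [s [vs h]]; exists s; split=> // t vt l.
have := h t vt l; rewrite lerBlDr => /le_trans; apply.
rewrite mulr_sumr -big_split ler_sum //= => k _.
have := bp s t k l vs vt; have := ler_norm ((p k - p' k) * pay s t k l).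
rewrite normrM => h1 h2.
have := ler_wpM2l (normr_ge0 (p k - p' k)) h2; nra.
Qed.

Lemma guaranteed_close pay pay' p g (x : R) : (forall k, 0 <= p k) ->
  (forall s t k l, valid1 s -> valid2 t -> `|pay s t k l - pay' s t k l| <= x) ->
  guaranteed pay p g -> guaranteed pay' p (fun l => g l - x * \sum_k p k).
Proof.
move=> p0 close [s [vs h]]; exists s; split=> // t vt l.
have := h t vt l; rewrite lerBlDr => /le_trans; apply.
rewrite mulr_sumr -big_split ler_sum //= => k _.
have := close s t k l vs vt; rewrite ler_norml => /andP[_].
move/(ler_wpM2l (p0 k)); nra.
Qed.

Lemma valid_dirac1 : valid1 ((fun _ _ => dirac_ffun R a0) : strat1).
Proof. by move=> k h; exact: dirac_distr. Qed.

Lemma valid_dirac2 : valid2 ((fun _ _ => dirac_ffun R b0) : strat2).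
Proof. by move=> k h; exact: dirac_distr. Qed.

Lemma guaranteed0 pay : guaranteed pay (fun=> 0) (fun=> 0).
Proof.
exists (fun _ _ => dirac_ffun R a0); split; first exact: valid_dirac1.
by move=> t vt l; rewrite big1 // => k _; rewrite mul0r.
Qed.

Definition reply_values (pay : payoff) (p : K -> R) (s : strat1) (l : L) :=
  [set y | exists t, valid2 t /\ y = \sum_k p k * pay s t k l].

Lemma has_inf_reply pay p s l : bounded_payoff c pay -> valid1 s ->
  has_inf (reply_values pay p s l).
Proof.
move=> bp vs; split.
  by eexists; exists (fun _ _ => dirac_ffun R b0); split; first exact: valid_dirac2.
exists (- \sum_k `|p k| * c) => _ [t [vt ->]].
rewrite -sumrN ler_sum // => k _.
have := bp s t k l vs vt; have := ler_norm (- (p k * pay s t k l)).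
rewrite normrN normrM => h1 h2.
have := ler_wpM2l (normr_ge0 (p k)) h2; lra.
Qed.

Lemma reply_ge pay p s t l : bounded_payoff c pay -> valid1 s -> valid2 t ->
  inf (reply_values pay p s l) <= \sum_k p k * pay s t k l.
Proof.
move=> bp vs vt; apply: ge_inf; first by case: (has_inf_reply p l bp vs).
by exists t.
Qed.

Lemma guaranteed_reply pay p s : bounded_payoff c pay -> valid1 s ->
  guaranteed pay p (fun l => inf (reply_values pay p s l)).
Proof. by move=> bp vs; exists s; split=> // t vt l; exact: reply_ge. Qed.

(** Player 2 knows his type, so near-optimal replies chosen separately for each [l] are glued into
    one strategy. *)
Lemma best_reply pay p s (e : R) : bounded_payoff c pay -> typewise pay ->
  valid1 s -> 0 < e ->
  exists t, valid2 t /\ forall l,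
    \sum_k p k * pay s t k l <= inf (reply_values pay p s l) + e.
Proof.
move=> bp tp vs e0.
have /choice[f fP] : forall l, exists t, valid2 t /\
    \sum_k p k * pay s t k l <= inf (reply_values pay p s l) + e.
  move=> l; have [_ [t [vt ->]] lt] := inf_adherent e0 (has_inf_reply p l bp vs).
  by exists t; split=> //; exact: ltW.
exists (fun l => f l l); split=> [l h|l]; first exact: (fP l).1.
apply: le_trans (fP l).2; rewrite ler_sum // => k _.
by rewrite (tp _ _ (f l)).
Qed.

Definition extends_by_stage (pay pay' : payoff) := forall s t k l,
  valid1 s -> valid2 t -> pay' s t k l = prefix_stage M lam pay s t k l.

(** Player 2's first move becomes the outermost average, and [p] enters only through [p k * s k [::]
    a], the unnormalised posterior weight of [k] after [a]. *)
Lemma prefix_stage_weighted pay p s t l :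
  \sum_k p k * prefix_stage M lam pay s t k l =
  \sum_b t l [::] b * \sum_a
    (lam * (\sum_k (p k * s k [::] a) * M k l a b) + (1 - lam) *
      \sum_k (p k * s k [::] a)
        * pay (shift1 (a, b) s) (shift2 (a, b) t) k l).
Proof.
pose X k a b := t l [::] b * ((p k * s k [::] a) * (lam * M k l a b
     + (1 - lam) * pay (shift1 (a, b) s) (shift2 (a, b) t) k l)).
transitivity (\sum_k \sum_a \sum_b X k a b).
  apply: eq_bigr => k _; rewrite mulr_sumr; apply: eq_bigr => a _.
  rewrite !mulr_sumr; apply: eq_bigr => b _; rewrite /X; ring.
rewrite exchange_big /=; under eq_bigr => a _ do rewrite exchange_big /=.
rewrite exchange_big /=; apply: eq_bigr => b _.
rewrite mulr_sumr; apply: eq_bigr => a _.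
rewrite !mulr_sumr -big_split mulr_sumr; apply: eq_bigr => k _ /=; rewrite /X; ring.
Qed.

(** [P a] is the unnormalised posterior after [a], and [d a b] is what the continuation of [s]
    secures there. The bound on [g] follows by letting player 2 open with [b] and then reply almost
    optimally. *)
Lemma guaranteed_prefix_inv pay pay' p g :
  bounded_payoff c pay -> typewise pay -> extends_by_stage pay pay' ->
  (forall k, 0 <= p k) -> guaranteed pay' p g ->
  exists (P : A -> K -> R) (d : A -> B -> L -> R),
    [/\ forall a k, 0 <= P a k, forall k, \sum_a P a k = p k,
        forall a b, guaranteed pay (P a) (d a b) &
        forall b l, g l <= \sum_a (lam * (\sum_k P a k * M k l a b)
                                   + (1 - lam) * d a b l)].
Proof.
move=> bp tp pp p0 [s [vs h]].
pose P a k := p k * s k [::] a.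
pose d a b l := inf (reply_values pay (P a) (shift1 (a, b) s) l).
exists P, d; split=> [a k|k|a b|b l].
- by rewrite mulr_ge0 // (vs k [::]).1.
- by rewrite /P -mulr_sumr (vs k [::]).2 mulr1.
- by apply: guaranteed_reply => //; exact: valid_shift1.
apply/ler_addgt0Pr => e e0.
(* One such error is made for each action [a]; the successor keeps the denominator positive. *)
have e'0 : 0 < e / #|A|.+1%:R by rewrite divr_gt0.
have /choice[f fP] : forall x : A * B, exists t, valid2 t /\ forall l,
    \sum_k P x.1 k * pay (shift1 x s) t k l <= d x.1 x.2 l + e / #|A|.+1%:R.
  by case=> a b'; apply: best_reply => //; exact: valid_shift1.
pose t : strat2 := fun l h => if h is x :: h' then f x l h' else dirac_ffun R b.
have vt : valid2 t.
  by move=> l' [|x h']; [exact: dirac_distr|exact: (fP x).1].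
apply: le_trans (h t vt l) _.
under eq_bigr => k _ do rewrite pp //.
rewrite prefix_stage_weighted sum_dirac.
apply: (@le_trans _ _ (\sum_a (lam * (\sum_k P a k * M k l a b)
    + (1 - lam) * (d a b l + e / #|A|.+1%:R)))).
  rewrite ler_sum // => a _; rewrite lerD2l ler_pM2l ?subr_gt0 //.
  exact: (fP (a, b)).2 l.
under eq_bigr => a _ do rewrite mulrDr addrA.
rewrite big_split /= lerD2l sumr_const -mulrnAr.
move: e'0; set e' := e / _ => e'0.
have -> : e = e' + e' *+ #|A| by rewrite -mulrS -mulr_natr divfK.
have : 0 <= e' *+ #|A| by rewrite mulrn_wge0 // ltW.
by move: lam0 lam1 e'0; nra.
Qed.

(** Conversely, a splitting of [p] is realised by playing [a] with probability [P a k / p k],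
    followed by strategies securing the vectors [d a b]. *)
Lemma guaranteed_prefix pay pay' (p : K -> R) (g : L -> R)
    (P : A -> K -> R) (d : A -> B -> L -> R) :
  extends_by_stage pay pay' ->
  (forall a k, 0 <= P a k) -> (forall k, \sum_a P a k = p k) ->
  (forall a b, guaranteed pay (P a) (d a b)) ->
  (forall b l, g l <= \sum_a (lam * (\sum_k P a k * M k l a b)
                                   + (1 - lam) * d a b l)) ->
  guaranteed pay' p g.
Proof.
move=> pp P0 Pp gP gd.
have /choice[f fP] : forall x : A * B, exists s, valid1 s /\ forall t,
    valid2 t -> forall l, d x.1 x.2 l <= \sum_k P x.1 k * pay s t k l.
  by case=> a b; exact: gP.
(* If [p k = 0] then every [P a k] vanishes, so an arbitrary distribution still satisfies
   [p k * s0 k a = P a k]. *)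
pose s0 k : {ffun A -> R} :=
  if p k == 0 then dirac_ffun R a0 else [ffun a => P a k / p k].
have p0 k : 0 <= p k by rewrite -Pp sumr_ge0.
have s0P k a : p k * s0 k a = P a k.
  rewrite /s0; case: ifPn => [/eqP pk0|pk0]; last by rewrite ffunE mulrCA divff ?mulr1.
  have Pk0 : \sum_a P a k = 0 by rewrite Pp.
  by rewrite pk0 mul0r (psumr_eq0P (fun a _ => P0 a k) Pk0).
pose s : strat1 := fun k h => if h is x :: h' then f x k h' else s0 k.
have vs : valid1 s.
  move=> k [|x h']; last exact: (fP x).1.
  rewrite /s /s0; case: ifPn => [_|pk0]; first exact: dirac_distr.
  split=> [a|]; first by rewrite ffunE divr_ge0.
  by under eq_bigr => a _ do rewrite ffunE; rewrite -mulr_suml Pp divff.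
exists s; split=> // t vt l.
under eq_bigr => k _ do rewrite pp //.
rewrite prefix_stage_weighted; apply: mean_ge => // b.
apply: le_trans (gd b l) _; rewrite ler_sum // => a _.
rewrite lerD //.
  by rewrite ler_pM2l // ler_sum // => k _; rewrite s0P.
rewrite ler_pM2l ?subr_gt0 //.
apply: le_trans ((fP (a, b)).2 _ (valid_shift2 (a, b) vt) l) _.
by rewrite ler_sum // => k _; rewrite s0P.
Qed.

(** Convexity of the cone of guaranteed pairs; the slack [e] makes room for the truncation error of
    the infinite game. *)
Definition superadditive pay := forall p p' g g' (e : R),
  (forall k, 0 <= p k) -> (forall k, 0 <= p' k) -> 0 < e ->
  guaranteed pay p g -> guaranteed pay p' g' ->
  guaranteed pay (fun k => p k + p' k) (fun l => g l + g' l - e).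

(** The loss is proportional to the mass of [p], so that losses add up when [p] is split. *)
Definition included (D : R) pay1 pay2 := forall p g (e : R),
  (forall k, 0 <= p k) -> 0 < e -> guaranteed pay1 p g ->
  guaranteed pay2 p (fun l => g l - (D + e) * \sum_k p k).

(** The stage payoffs agree and only the continuation vectors lose [D + e] per unit of mass; the
    masses of the [P a] sum to that of [p], and the factor [1 - lam] remains. *)
Lemma included_prefix D pay1 pay1' pay2 pay2' :
  bounded_payoff c pay1 -> typewise pay1 ->
  extends_by_stage pay1 pay1' -> extends_by_stage pay2 pay2' ->
  included D pay1 pay2 -> included ((1 - lam) * D) pay1' pay2'.
Proof.
move=> bp tp pp1 pp2 inc p g e p0 e0 gp.
have [P [d [P0 Pp dP gd]]] := guaranteed_prefix_inv bp tp pp1 p0 gp.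
apply: (guaranteed_prefix pp2 P0 Pp (fun a b => inc _ _ _ (P0 a) e0 (dP a b))).
move=> b l /=.
have -> : \sum_a (lam * (\sum_k P a k * M k l a b)
    + (1 - lam) * (d a b l - (D + e) * \sum_k P a k)) =
  \sum_a (lam * (\sum_k P a k * M k l a b) + (1 - lam) * d a b l)
    - (1 - lam) * (D + e) * \sum_a \sum_k P a k.
  by rewrite mulr_sumr -sumrB; apply: eq_bigr => a _; ring.
rewrite lerB // exchange_big /=.
under eq_bigr => k _ do rewrite Pp.
rewrite ler_wpM2r ?sumr_ge0 //.
by move: lam0 e0; nra.
Qed.

Lemma included_simplex D pay1 pay2 :
  (forall (p : {ffun K -> R}) g (e : R), is_distr p -> 0 < e ->
     guaranteed pay1 p g -> guaranteed pay2 p (fun l => g l - D - e)) ->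
  included D pay1 pay2.
Proof.
move=> h p g e p0 e0 gp.
have [S0|S0] := eqVneq (\sum_k p k) 0.
  have pk k : p k = 0 by exact: (psumr_eq0P (fun k _ => p0 k) S0).
  have [s [vs gs]] := gp; exists s; split=> // t vt l.
  have := gs t vt l; rewrite S0 mulr0 subr0 => /le_trans; apply.
  by rewrite ler_sum // => k _; rewrite pk !mul0r.
have Sp : 0 < \sum_k p k by rewrite lt_neqAle eq_sym S0 sumr_ge0.
set S := \sum_k p k in S0 Sp *.
pose q := [ffun k => S^-1 * p k].
have dq : is_distr q.
  split=> [k|]; first by rewrite ffunE mulr_ge0 // invr_ge0 ltW.
  by under eq_bigr => k _ do rewrite ffunE; rewrite -mulr_sumr mulVf.
have gq : guaranteed pay1 q (fun l => S^-1 * g l).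
  rewrite (_ : (q : K -> R) = (fun k => S^-1 * p k)).
    by apply: guaranteed_scale => //; rewrite invr_ge0 ltW.
  by apply/funext => k; rewrite ffunE.
have := guaranteed_scale (ltW Sp) (h q _ e dq e0 gq).
rewrite (_ : (fun k => S * q k) = p); last first.
  by apply/funext => k; rewrite ffunE mulVKf.
by apply: guaranteed_le => l; rewrite !mulrBr mulVKf // mulrDl; lra.
Qed.

End Guarantees.

(** * Values of the dual games *)

Section Values.
Set Implicit Arguments.
Unset Strict Implicit.
Variables (R : realType) (K L A B : finType).
Variables (M : K -> L -> A -> B -> R) (lam c : R).
Hypotheses (lam0 : 0 < lam) (lam1 : lam < 1).
Hypotheses (c0 : 0 <= c) (Mc : forall k l a b, `|M k l a b| <= c).
Variables (k0 : K) (l0 : L) (a0 : A) (b0 : B).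

Local Notation strat1 := (strat1 R K A B).
Local Notation strat2 := (strat2 R L A B).
Local Notation payoff := (strat1 -> strat2 -> K -> L -> R).

Implicit Types (pay : payoff) (mu : {ffun K -> R}) (nu : {ffun L -> R}).

(** The splittings of [p] and [p'] by the first action are added; [guaranteed_prefix] turns the sum
    back into a behaviour strategy, so no mixed strategy is formed. *)
Lemma payoffT_superadditive n (p p' : K -> R) (g g' : L -> R) :
  (forall k, 0 <= p k) -> (forall k, 0 <= p' k) ->
  guaranteed (payoffT M lam n) p g -> guaranteed (payoffT M lam n) p' g' ->
  guaranteed (payoffT M lam n) (fun k => p k + p' k) (fun l => g l + g' l).
Proof.
elim: n p p' g g' => [|n IH] p p' g g' p0 p'0.
  move=> [s [vs h]] [s' [vs' h']]; exists s; split=> // t vt l.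
  have := h t vt l; have := h' t vt l.
  by rewrite /payoffT /= -!mulr_suml !mulr0; lra.
have pp : extends_by_stage M lam (payoffT M lam n) (payoffT M lam n.+1).
  by move=> s t k l _ _; exact: payoffTS.
have bp := payoffT_bounded lam0 lam1 Mc n c0.
have tp := payoffT_typewise M lam n.
move=> /(guaranteed_prefix_inv lam0 lam1 b0 bp tp pp p0) [P [d [P0 Pp dP gd]]].
move=> /(guaranteed_prefix_inv lam0 lam1 b0 bp tp pp p'0) [P' [d' [P'0 Pp' dP' gd']]].
apply: (guaranteed_prefix lam0 lam1 a0 pp (P := fun a k => P a k + P' a k)
  (d := fun a b l => d a b l + d' a b l)) => [a k|k|a b|b l].
- by rewrite addr_ge0.
- by rewrite big_split /= Pp Pp'.
- exact: IH.
apply: le_trans (lerD (gd b l) (gd' b l)) _.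
rewrite -big_split ler_sum //= => a _.
under [X in _ <= _ * X + _]eq_bigr => k _ do rewrite mulrDl.
by rewrite big_split /=; lra.
Qed.

Lemma payoff_inf_superadditive : superadditive (payoff_inf M lam).
Proof.
move=> p p' g g' e p0 p'0 e0 h h'.
set S := \sum_k (p k + p' k).
have S0 : 0 <= S by apply: sumr_ge0 => k _; rewrite addr_ge0.
(* Passing to the game with [n] stages and back costs [c * (1 - lam) ^+ n] per unit of mass each
   way, hence the factor 2. *)
have [n ne] : exists n, (c * (1 - lam) ^+ n) * (2 * S) < e.
  apply/not_existsP => hn.
  have : e <= 0.
    apply: (@le_geometric _ (c * (2 * S)) (1 - lam)) => [|n].
      exact: discount_lt1.
    by rewrite add0r; have /negP := hn n; rewrite -leNgt mulrAC.
  by move: e0; lra.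
have {}h := guaranteed_close p0 (fun s t k l => payoff_inf_close lam0 lam1 Mc n k l c0) h.
have {}h' := guaranteed_close p'0 (fun s t k l => payoff_inf_close lam0 lam1 Mc n k l c0) h'.
have pp0 k : 0 <= p k + p' k by rewrite addr_ge0.
have cl' s t k l : valid1 s -> valid2 t ->
    `|payoffT M lam n s t k l - payoff_inf M lam s t k l| <= c * (1 - lam) ^+ n.
  by move=> vs vt; rewrite distrC; exact: payoff_inf_close.
have := guaranteed_close pp0 cl' (payoffT_superadditive p0 p'0 h h').
apply: guaranteed_le => l; rewrite -/S.
have : S = \sum_k p k + \sum_k p' k by rewrite /S big_split.
by move: ne; set x := c * _; nra.
Qed.

Lemma dual1_payoffE pay mu q (pi : {ffun K -> R}) s t : is_distr q ->
  dual1_payoff pay mu q pi s t =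
  \sum_k pi k * mu k + \sum_l q l * \sum_k pi k * pay s t k l.
Proof.
move=> dq; rewrite /dual1_payoff.
under [X in _ + X]eq_bigr => l _ do rewrite mulr_sumr.
rewrite exchange_big -big_split; apply: eq_bigr => k _ /=.
under eq_bigr => l _ do rewrite mulrDr.
rewrite big_split /= mean_cst // mulrDr mulr_sumr; congr (_ + _).
by apply: eq_bigr => l _; ring.
Qed.

Lemma dual2_payoffE pay p nu (rho : {ffun L -> R}) s t : is_distr p ->
  dual2_payoff pay p nu rho s t =
  \sum_l rho l * (nu l + \sum_k p k * pay s t k l).
Proof.
move=> dp; rewrite /dual2_payoff.
under eq_bigr => k _ do rewrite mulr_sumr.
rewrite exchange_big; apply: eq_bigr => l _ /=.
rewrite mulrDr -[X in _ = _ * X + _](mean_cst (nu l) dp) !mulr_sumr -big_split.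
by apply: eq_bigr => k _ /=; ring.
Qed.

Lemma is_distr_ge0 (T : finType) (p : {ffun T -> R}) x : is_distr p -> 0 <= p x.
Proof. by case. Qed.

Lemma mean_payoff_bounded pay (p : {ffun K -> R}) s t l :
  bounded_payoff c pay -> is_distr p -> valid1 s -> valid2 t ->
  `|\sum_k p k * pay s t k l| <= c.
Proof. by move=> bp dp vs vt; apply: mean_norm => // k; exact: bp. Qed.

Lemma dual1_payoff_has_lbound pay mu (q : {ffun L -> R}) (pi : {ffun K -> R}) s :
  bounded_payoff c pay -> is_distr pi -> is_distr q -> valid1 s ->
  has_lbound [set w | exists t, valid2 t /\ w = dual1_payoff pay mu q pi s t].
Proof.
move=> bp dpi dq vs.
exists (\sum_k pi k * mu k + \sum_l q l * (- c)) => _ [t [vt ->]].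
rewrite dual1_payoffE // lerD2l ler_sum // => l _.
rewrite ler_wpM2l ?is_distr_ge0 //.
by have := mean_payoff_bounded l bp dpi vs vt; rewrite ler_norml => /andP[].
Qed.

Lemma dual2_payoff_has_lbound pay (p : {ffun K -> R}) nu s :
  bounded_payoff c pay -> is_distr p -> valid1 s ->
  has_lbound [set w | exists rho t, is_distr rho /\ valid2 t /\
    w = dual2_payoff pay p nu rho s t].
Proof.
move=> bp dp vs.
exists (- (\sum_l `|nu l| + c)) => _ [rho [t [drho [vt ->]]]].
rewrite dual2_payoffE //; apply: mean_ge => // l.
have := mean_payoff_bounded l bp dp vs vt; rewrite ler_norml => /andP[h1 _].
have : `|nu l| <= \sum_l `|nu l| by rewrite (bigD1 l) //= lerDl sumr_ge0.
by have := ler_norm (- nu l); rewrite normrN; lra.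
Qed.

(** Together with [dual1_value_le], this describes the value as a supremum over guaranteed
    vectors. *)
Lemma dual1_value_ge pay mu (q : {ffun L -> R}) (pi : {ffun K -> R}) g :
  bounded_payoff c pay -> is_distr pi -> is_distr q -> guaranteed pay pi g ->
  \sum_k pi k * mu k + \sum_l q l * g l <= dual1_value pay mu q.
Proof.
move=> bp dpi dq [s [vs h]].
apply: (@le_trans _ _ (inf [set w | exists t, valid2 t /\
    w = dual1_payoff pay mu q pi s t])).
  apply: lb_le_inf.
    eexists; exists (fun _ _ => dirac_ffun R b0).
    by split; first exact: valid_dirac2.
  move=> _ [t [vt ->]]; rewrite dual1_payoffE // lerD2l ler_sum // => l _.
  by rewrite ler_wpM2l ?h // is_distr_ge0.
apply: ub_le_sup; last by exists pi, s.
exists (\sum_k `|mu k| + c) => _ [pi' [s' [dpi' [vs' ->]]]].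
pose t : strat2 := fun _ _ => dirac_ffun R b0.
have vt : valid2 t by exact: valid_dirac2.
apply: (@le_trans _ _ (dual1_payoff pay mu q pi' s' t)).
  by apply: ge_inf; [exact: dual1_payoff_has_lbound|exists t].
rewrite dual1_payoffE // lerD //.
  apply: ler_sum => k _.
  have pi1 : pi' k <= 1.
    by rewrite -dpi'.2 (bigD1 k) //= lerDl sumr_ge0 // => j _; rewrite is_distr_ge0.
  have := ler_norm (mu k); have := normr_ge0 (mu k).
  by have := is_distr_ge0 k dpi'; nra.
apply: le_trans (ler_norm _) _; apply: mean_norm => // l.
exact: mean_payoff_bounded.
Qed.

Lemma dual1_value_le pay mu (q : {ffun L -> R}) (y : R) :
  bounded_payoff c pay -> typewise pay -> is_distr q ->
  (forall (pi : {ffun K -> R}) g, is_distr pi -> guaranteed pay pi g ->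
    \sum_k pi k * mu k + \sum_l q l * g l <= y) ->
  dual1_value pay mu q <= y.
Proof.
move=> bp tp dq h; apply: ge_sup.
  eexists; exists (dirac_ffun R k0), (fun _ _ => dirac_ffun R a0).
  by split; [exact: dirac_distr|split; first exact: valid_dirac1].
move=> _ [pi [s [dpi [vs ->]]]].
apply/ler_addgt0Pr => e e0.
(* One reply is almost optimal for all types at once, so the infimum of the [q]-average is the
   [q]-average of the infima. *)
have [t [vt ht]] := best_reply b0 pi bp tp vs e0.
have := h _ _ dpi (guaranteed_reply b0 pi bp vs).
rewrite -(lerD2r e) => /(le_trans _); apply.
apply: (@le_trans _ _ (dual1_payoff pay mu q pi s t)).
  by apply: ge_inf; [exact: dual1_payoff_has_lbound|exists t].
rewrite dual1_payoffE // -addrA lerD2l -[X in _ + X](mean_cst e dq) -big_split.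
by rewrite ler_sum //= => l _; rewrite -mulrDr ler_wpM2l ?is_distr_ge0.
Qed.

Lemma dual2_value_ge pay (p : {ffun K -> R}) nu g (y : R) :
  bounded_payoff c pay -> is_distr p -> guaranteed pay p g ->
  (forall l, y <= nu l + g l) -> y <= dual2_value pay p nu.
Proof.
move=> bp dp [s [vs h]] hy.
apply: (@le_trans _ _ (inf [set w | exists rho t, is_distr rho /\ valid2 t /\
    w = dual2_payoff pay p nu rho s t])).
  apply: lb_le_inf.
    eexists; exists (dirac_ffun R l0), (fun _ _ => dirac_ffun R b0).
    by split; [exact: dirac_distr|split; first exact: valid_dirac2].
  move=> _ [rho [t [drho [vt ->]]]]; rewrite dual2_payoffE //.
  by apply: mean_ge => // l; rewrite (le_trans (hy l)) // lerD2l h.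
apply: ub_le_sup; last by exists s.
exists (nu l0 + c) => _ [s' [vs' ->]].
pose t : strat2 := fun _ _ => dirac_ffun R b0.
have vt : valid2 t by exact: valid_dirac2.
apply: (@le_trans _ _ (dual2_payoff pay p nu (dirac_ffun R l0) s' t)).
  apply: ge_inf; first exact: dual2_payoff_has_lbound.
  by exists (dirac_ffun R l0), t; split; first exact: dirac_distr.
rewrite dual2_payoffE // sum_dirac lerD2l.
by apply: le_trans (ler_norm _) _; exact: mean_payoff_bounded.
Qed.

Lemma dual2_value_le pay (p : {ffun K -> R}) nu (y : R) :
  bounded_payoff c pay -> is_distr p ->
  (forall g x, guaranteed pay p g -> (forall l, x <= nu l + g l) -> x <= y) ->
  dual2_value pay p nu <= y.
Proof.
move=> bp dp h; apply: ge_sup.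
  by eexists; exists (fun _ _ => dirac_ffun R a0); split; first exact: valid_dirac1.
move=> _ [s [vs ->]]; set v := inf _.
(* Player 2 may choose any type [l] for sure, so the worst payoff [v] of [s] makes [v - nu l] a
   guaranteed vector. *)
apply: (h (fun l => v - nu l)) => [|l]; last by rewrite addrC subrK.
exists s; split=> // t vt l; rewrite lerBlDl.
have -> : nu l + \sum_k p k * pay s t k l =
    dual2_payoff pay p nu (dirac_ffun R l) s t by rewrite dual2_payoffE // sum_dirac.
apply: ge_inf; first exact: dual2_payoff_has_lbound.
by exists (dirac_ffun R l), t; split; first exact: dirac_distr.
Qed.

Lemma dual1_value_included D pay1 pay2 mu (q : {ffun L -> R}) :
  bounded_payoff c pay1 -> typewise pay1 -> bounded_payoff c pay2 ->
  included D pay1 pay2 -> is_distr q ->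
  dual1_value pay1 mu q <= dual1_value pay2 mu q + D.
Proof.
move=> bp1 tp1 bp2 inc dq; apply: dual1_value_le => // pi g dpi gpi.
apply/ler_addgt0Pr => e e0.
have := dual1_value_ge mu bp2 dpi dq (inc _ _ e dpi.1 e0 gpi).
rewrite dpi.2 mulr1; under [X in _ + X]eq_bigr => l _ do rewrite mulrBr.
by rewrite sumrB mean_cst //; lra.
Qed.

Lemma dual2_value_included D pay1 pay2 (p : {ffun K -> R}) nu :
  bounded_payoff c pay1 -> bounded_payoff c pay2 ->
  included D pay1 pay2 -> is_distr p ->
  dual2_value pay1 p nu <= dual2_value pay2 p nu + D.
Proof.
move=> bp1 bp2 inc dp; apply: dual2_value_le => // g x gp xg.
apply/ler_addgt0Pr => e e0.
have := inc _ _ e dp.1 e0 gp; rewrite dp.2 mulr1 => gp2.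
have : x - (D + e) <= dual2_value pay2 p nu.
  by apply: (dual2_value_ge bp2 dp gp2) => l; have := xg l; lra.
by lra.
Qed.

(** At [nu = - g] the first value is at least 0; if [g - D - e] were not guaranteed for [pay2], the
    second would be at most [- D - e]. *)
Lemma included_dual2 D pay1 pay2 :
  bounded_payoff c pay1 -> bounded_payoff c pay2 ->
  (forall p nu, is_distr p ->
     dual2_value pay1 p nu <= dual2_value pay2 p nu + D) ->
  included D pay1 pay2.
Proof.
move=> bp1 bp2 h; apply: included_simplex => p g e dp e0 gp.
apply: contrapT => ng.
pose nu : {ffun L -> R} := [ffun l => - g l].
have : 0 <= dual2_value pay1 p nu.
  by apply: (dual2_value_ge bp1 dp gp) => l; rewrite ffunE addNr.
have : dual2_value pay2 p nu <= - D - e.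
  apply: dual2_value_le => // g' x gp' xg'.
  rewrite leNgt; apply/negP => lt; apply: ng.
  by apply: guaranteed_le gp' => l; have := xg' l; rewrite ffunE; lra.
by have := h p nu dp; lra.
Qed.

End Values.

(** * Separation from the cone of guaranteed pairs *)

Section Separation.
Set Implicit Arguments.
Unset Strict Implicit.
Variables (R : realType) (K L A B : finType) (c : R).
Hypothesis c0 : 0 <= c.
Variables (k0 : K) (l0 : L) (a0 : A) (b0 : B).

Local Notation strat1 := (strat1 R K A B).
Local Notation strat2 := (strat2 R L A B).
Local Notation payoff := (strat1 -> strat2 -> K -> L -> R).
Local Notation vec := {ffun (K + L)%type -> R^o}.

Implicit Types (pay : payoff) (x : vec).

(* [gap pay (p, v)] is the least [m] such that [v - m] is guaranteed at [p].
   Moving [p] by [x] costs at most [c * x], so the infimum over all [p'] of this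
   penalised cost is exact and yields a finite sublinear function. *)
Definition gap_values (pay : payoff) (x : vec) : set R :=
  [set y | exists p g m, [/\ forall k, 0 <= p k, guaranteed pay p g,
     forall l, x (inr l) - g l <= m &
     y = c * (\sum_k `|x (inl k) - p k|) + m]].

Definition gap pay x := inf (gap_values pay x).

(** A vector guaranteed at [p] has entries at most [c * \sum_k p k]; the penalty of weight [c]
    offsets this up to a constant depending on [x]. *)
Lemma has_inf_gap pay x : bounded_payoff c pay -> has_inf (gap_values pay x).
Proof.
move=> bp; split.
  eexists; exists (fun=> 0), (fun=> 0), (\sum_l `|x (inr l)|); split=> // [|l].
    exact: guaranteed0.
  rewrite subr0 (le_trans (ler_norm _)) // (bigD1 l) //= lerDl sumr_ge0 //.
exists (x (inr l0) - c * \sum_k `|x (inl k)|) => _ [p [g [m [p0 gp hm ->]]]].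
have [s [vs h]] := gp; have vt := @valid_dirac2 R L A B b0.
have h1 := h _ vt l0; have h2 := hm l0.
have h3 : \sum_k p k * pay s (fun _ _ => dirac_ffun R b0) k l0 <= c * \sum_k p k.
  rewrite mulr_sumr ler_sum // => k _; rewrite mulrC ler_wpM2r //.
  by apply: le_trans (ler_norm _) _; exact: bp.
have h4 : \sum_k p k <= \sum_k `|x (inl k) - p k| + \sum_k `|x (inl k)|.
  rewrite -big_split ler_sum //= => k _.
  have := ler_norm (x (inl k)); have := ler_norm (- (x (inl k) - p k)).
  by rewrite normrN; lra.
by have := ler_wpM2l c0 h4; rewrite mulrDr; lra.
Qed.

Lemma gap_le pay x p g m : bounded_payoff c pay -> (forall k, 0 <= p k) ->
  guaranteed pay p g -> (forall l, x (inr l) - g l <= m) ->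
  gap pay x <= c * (\sum_k `|x (inl k) - p k|) + m.
Proof.
move=> bp p0 gp hm; apply: ge_inf; first by case: (has_inf_gap x bp).
by exists p, g, m.
Qed.

Lemma gap_sublinear pay : bounded_payoff c pay -> superadditive pay ->
  sublinear R (gap pay).
Proof.
move=> bp sp; split=> [x y|r x r0]; apply/ler_addgt0Pr => e e0.
  (* Two thirds pay for the two infima, one for the slack in [superadditive]. *)
  have e3 : 0 < e / 3 by lra.
  have [_ [p [g [m [p0 gp hm ->]]]] lt] := inf_adherent e3 (has_inf_gap x bp).
  have [_ [p' [g' [m' [p'0 gp' hm' ->]]]] lt'] := inf_adherent e3 (has_inf_gap y bp).
  have pp0 k : 0 <= p k + p' k by rewrite addr_ge0.
  have hmm l : (x + y) (inr l) - (g l + g' l - e / 3) <= m + m' + e / 3.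
    by rewrite ffunE; have := hm l; have := hm' l; lra.
  apply: le_trans (gap_le bp pp0 (sp _ _ _ _ _ p0 p'0 e3 gp gp') hmm) _.
  have : c * (\sum_k `|(x + y) (inl k) - (p k + p' k)|) <=
      c * (\sum_k `|x (inl k) - p k|) + c * (\sum_k `|y (inl k) - p' k|).
    rewrite -mulrDr ler_wpM2l // -big_split ler_sum //= => k _.
    by rewrite ffunE opprD addrACA ler_normD.
  by rewrite /gap; lra.
have er : 0 < e / r by rewrite divr_gt0.
have [_ [p [g [m [p0 gp hm ->]]]] lt] := inf_adherent er (has_inf_gap x bp).
have rp0 k : 0 <= r * p k by rewrite mulr_ge0 // ltW.
have hmm l : (r *: x) (inr l) - r * g l <= r * m.
  by rewrite ffunE -mulrBr ler_pM2l.
apply: le_trans (gap_le bp rp0 (guaranteed_scale (ltW r0) gp) hmm) _.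
rewrite (eq_bigr (fun k => r * `|x (inl k) - p k|)); last first.
  by move=> k _; rewrite ffunE -mulrBr normrM gtr0_norm.
rewrite -mulr_sumr mulrCA -mulrDr.
rewrite -ler_pdivlMl // mulrDr mulKf ?gt_eqF // [r^-1 * e]mulrC.
exact: ltW.
Qed.

(** A functional [w] supporting [gap pay2] at [(p, g)] splits into [mu] and [q]. As the gap is at
    most 0 on guaranteed pairs, the value for [pay2] is at most 0, while the value for [pay1] is at
    least [w] at [(p, g)], that is, at least the gap there; so this gap is at most [D]. *)
Lemma included_dual1 D pay1 pay2 :
  bounded_payoff c pay1 -> bounded_payoff c pay2 -> typewise pay2 ->
  superadditive pay2 ->
  (forall mu q, is_distr q ->
     dual1_value pay1 mu q <= dual1_value pay2 mu q + D) ->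
  included D pay1 pay2.
Proof.
move=> bp1 bp2 tp2 sp h; apply: included_simplex => p g e dp e0 gp.
pose x0 : vec := [ffun i => match i with inl k => p k | inr l => g l end].
have [w [wle wx0]] := sublinear_support R _ _ x0 (gap_sublinear bp2 sp).
pose mu : {ffun K -> R} := [ffun k => w (inl k)].
pose q : {ffun L -> R} := [ffun l => w (inr l)].
have split_sum (x : vec) : \sum_i w i * x i =
    \sum_k x (inl k) * mu k + \sum_l q l * x (inr l).
  rewrite big_sumType /=; congr (_ + _); apply: eq_bigr => i _.
    by rewrite ffunE mulrC.
  by rewrite ffunE.
(* The point [(0, v)] is compared with the guaranteed pair [(0, 0)]. Taking [v] to be minus an
   indicator, then 1 and -1, shows that [q] is a distribution. *)
have vert (v : L -> R) m : (forall l, v l <= m) -> \sum_l q l * v l <= m.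
  move=> vm; pose x : vec := [ffun i => if i is inr l then v l else 0].
  have x0' l : x (inr l) - 0 <= m by rewrite ffunE subr0.
  have := gap_le bp2 (fun=> lexx 0) (guaranteed0 a0 pay2) x0'.
  have := wle x; rewrite split_sum => h1 h2.
  have := le_trans h1 h2; rewrite [X in X + _ <= _]big1 => [|k _]; last by rewrite ffunE mul0r.
  rewrite [X in _ <= c * X + _]big1 => [|k _]; last by rewrite ffunE subr0 normr0.
  rewrite mulr0 !add0r (eq_bigr (fun l => q l * v l)) // => l _.
  by rewrite [x _]ffunE.
have dq : is_distr q.
  split=> [l|].
    have := vert (fun l' => - (l' == l)%:R) 0.
    rewrite (bigD1 l) //= eqxx big1 => [|l' /negbTE ->]; last by rewrite oppr0 mulr0.
    rewrite addr0 mulrN1 oppr_le0; apply=> l'.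
    by rewrite oppr_le0 ler0n.
  apply/eqP; rewrite eq_le; apply/andP; split.
    have := vert (fun=> 1) 1 (fun=> lexx 1).
    by under eq_bigr => l _ do rewrite mulr1.
  have := vert (fun=> -1) (-1) (fun=> lexx _).
  by under eq_bigr => l _ do rewrite mulrN1; rewrite sumrN lerN2.
have v2 : dual1_value pay2 mu q <= 0.
  apply: (dual1_value_le k0 a0 b0 bp2 tp2 dq) => pi g' dpi gpi.
  pose x : vec := [ffun i => match i with inl k => pi k | inr l => g' l end].
  have x0' l : x (inr l) - g' l <= 0 by rewrite ffunE subrr.
  have := gap_le bp2 dpi.1 gpi x0'.
  rewrite big1 => [|k _]; last by rewrite ffunE subrr normr0.
  rewrite mulr0 addr0 => gx.
  apply: le_trans gx; apply: le_trans (wle x); rewrite split_sum lerD // ler_sum // => i _.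
    by rewrite !ffunE.
  by rewrite !ffunE.
have gapD : gap pay2 x0 <= D.
  apply: (le_trans wx0); rewrite split_sum.
  apply: (@le_trans _ _ (dual1_value pay1 mu q)); last by have := h mu q dq; lra.
  apply: le_trans (dual1_value_ge b0 mu bp1 dp dq gp).
  by rewrite lerD // ler_sum // => i _; rewrite [x0 _]ffunE.
(* The near-optimal [p'] may differ from [p]; moving back costs exactly the penalty counted in the
   gap. *)
have [_ [p' [g' [m [p'0 gp' hm ->]]]] lt] := inf_adherent e0 (has_inf_gap x0 bp2).
apply: guaranteed_le (guaranteed_perturb p bp2 gp') => l.
have := hm l; rewrite ffunE.
have -> : \sum_k `|p' k - p k| = \sum_k `|x0 (inl k) - p' k|.
  by apply: eq_bigr => k _; rewrite ffunE distrC.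
by move: lt gapD; rewrite /gap; lra.
Qed.

End Separation.

(** * Contraction *)

Lemma sup_le_scale (R : realType) (S S' : set R) (r : R) :
  S !=set0 -> has_ubound S' ->
  (forall y, ubound S' y -> ubound S (r * y)) -> sup S <= r * sup S'.
Proof.
move=> S0 ubS' h; apply: ge_sup => //; apply: h => y S'y.
exact: ub_le_sup.
Qed.

Section Contraction.
Set Implicit Arguments.
Unset Strict Implicit.
Variables (R : realType) (K L A B : finType).
Variables (M : K -> L -> A -> B -> R) (lam c : R).
Hypotheses (lam0 : 0 < lam) (lam1 : lam < 1) (c0 : 0 <= c).
Variables (k0 : K) (l0 : L) (a0 : A) (b0 : B).

Local Notation payoff := (strat1 R K A B -> strat2 R L A B -> K -> L -> R).

Implicit Type pay : payoff.

Definition regular (pay : payoff) :=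
  [/\ bounded_payoff c pay, typewise pay & superadditive pay].

(** This crude bound makes the sup norms suprema of bounded sets. *)
Lemma included_bounded pay1 pay2 :
  bounded_payoff c pay1 -> bounded_payoff c pay2 -> included (c + c) pay1 pay2.
Proof.
move=> bp1 bp2 p g e p0 e0 gp.
have close s t k l : valid1 s -> valid2 t ->
    `|pay1 s t k l - pay2 s t k l| <= c + c.
  move=> vs vt; apply: le_trans (ler_normB _ _) _.
  by rewrite lerD ?bp1 ?bp2.
apply: guaranteed_le (guaranteed_close p0 close gp) => l.
by rewrite lerB // ler_wpM2r ?sumr_ge0 // lerDl ltW.
Qed.

(** A bound [y] on the value differences gives inclusions both ways; one stage scales them by
    [1 - lam], and they then bound the new value differences. *)
Lemma dual1_supnorm_contract pay1 pay1' pay2 pay2' :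
  regular pay1 -> regular pay1' -> regular pay2 -> regular pay2' ->
  extends_by_stage M lam pay1 pay1' -> extends_by_stage M lam pay2 pay2' ->
  supnorm1 (fun mu q => dual1_value pay1' mu q - dual1_value pay2' mu q)
    <= (1 - lam)
       * supnorm1 (fun mu q => dual1_value pay1 mu q - dual1_value pay2 mu q).
Proof.
move=> [b1 t1 s1] [b1' t1' _] [b2 t2 s2] [b2' t2' _] pp1 pp2.
have dl : is_distr (dirac_ffun R l0) by exact: dirac_distr.
apply: sup_le_scale.
- by eexists; exists [ffun=> 0], (dirac_ffun R l0).
- exists (c + c) => _ [mu [q [dq ->]]].
  have h1 := dual1_value_included k0 a0 b0 mu b1 t1 b2 (included_bounded b1 b2) dq.
  have h2 := dual1_value_included k0 a0 b0 mu b2 t2 b1 (included_bounded b2 b1) dq.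
  by rewrite ler_norml; lra.
move=> y hy _ [mu [q [dq ->]]].
have hle mu' q' : is_distr q' ->
    `|dual1_value pay1 mu' q' - dual1_value pay2 mu' q'| <= y.
  by move=> dq'; apply: hy; exists mu', q'.
have i12 : included y pay1 pay2.
  apply: (included_dual1 c0 k0 l0 a0 b0 b1 b2 t2 s2) => mu' q' dq'.
  by have := hle mu' q' dq'; rewrite ler_norml; lra.
have i21 : included y pay2 pay1.
  apply: (included_dual1 c0 k0 l0 a0 b0 b2 b1 t1 s1) => mu' q' dq'.
  by have := hle mu' q' dq'; rewrite ler_norml; lra.
have i12' := included_prefix lam0 lam1 a0 b0 b1 t1 pp1 pp2 i12.
have i21' := included_prefix lam0 lam1 a0 b0 b2 t2 pp2 pp1 i21.
have := dual1_value_included k0 a0 b0 mu b1' t1' b2' i12' dq.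
have := dual1_value_included k0 a0 b0 mu b2' t2' b1' i21' dq.
by rewrite ler_norml; lra.
Qed.

Lemma dual2_supnorm_contract pay1 pay1' pay2 pay2' :
  regular pay1 -> regular pay1' -> regular pay2 -> regular pay2' ->
  extends_by_stage M lam pay1 pay1' -> extends_by_stage M lam pay2 pay2' ->
  supnorm2 (fun p nu => dual2_value pay1' p nu - dual2_value pay2' p nu)
    <= (1 - lam)
       * supnorm2 (fun p nu => dual2_value pay1 p nu - dual2_value pay2 p nu).
Proof.
move=> [b1 t1 _] [b1' _ _] [b2 t2 _] [b2' _ _] pp1 pp2.
have dk : is_distr (dirac_ffun R k0) by exact: dirac_distr.
apply: sup_le_scale.
- by eexists; exists (dirac_ffun R k0), [ffun=> 0].
- exists (c + c) => _ [p [nu [dp ->]]].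
  have h1 := dual2_value_included l0 a0 b0 nu b1 b2 (included_bounded b1 b2) dp.
  have h2 := dual2_value_included l0 a0 b0 nu b2 b1 (included_bounded b2 b1) dp.
  by rewrite ler_norml; lra.
move=> y hy _ [p [nu [dp ->]]].
have hle p' nu' : is_distr p' ->
    `|dual2_value pay1 p' nu' - dual2_value pay2 p' nu'| <= y.
  by move=> dp'; apply: hy; exists p', nu'.
have i12 : included y pay1 pay2.
  apply: (included_dual2 l0 a0 b0 b1 b2) => p' nu' dp'.
  by have := hle p' nu' dp'; rewrite ler_norml; lra.
have i21 : included y pay2 pay1.
  apply: (included_dual2 l0 a0 b0 b2 b1) => p' nu' dp'.
  by have := hle p' nu' dp'; rewrite ler_norml; lra.
have i12' := included_prefix lam0 lam1 a0 b0 b1 t1 pp1 pp2 i12.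
have i21' := included_prefix lam0 lam1 a0 b0 b2 t2 pp2 pp1 i21.
have := dual2_value_included l0 a0 b0 nu b1' b2' i12' dp.
have := dual2_value_included l0 a0 b0 nu b2' b1' i21' dp.
by rewrite ler_norml; lra.
Qed.

Hypothesis Mc : forall k l a b, `|M k l a b| <= c.

Lemma payoffT_regular n : regular (payoffT M lam n).
Proof.
split; [exact: payoffT_bounded|exact: payoffT_typewise|].
move=> p p' g g' e p0 p'0 e0 gp gp'.
apply: guaranteed_le
  (payoffT_superadditive lam0 lam1 c0 Mc a0 b0 p0 p'0 gp gp') => l.
by rewrite gerBl ltW.
Qed.

Lemma payoff_inf_regular : regular (payoff_inf M lam).
Proof.
split; [exact: payoff_inf_bounded|exact: payoff_inf_typewise|].
exact: (payoff_inf_superadditive lam0 lam1 c0 Mc a0 b0).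
Qed.

End Contraction.

Theorem theorem4 (R : realType) (K L A B : finType)
  (M : K -> L -> A -> B -> R) (lam : R) (T : nat) :
  (0 < #|K|)%N -> (0 < #|L|)%N -> (0 < #|A|)%N -> (0 < #|B|)%N ->
  0 < lam < 1 ->
  supnorm1 (fun mu q => V1 M lam mu q - V1T M lam T.+1 mu q)
    <= (1 - lam) * supnorm1 (fun mu q => V1 M lam mu q - V1T M lam T mu q)
  /\
  supnorm2 (fun p nu => V2 M lam p nu - V2T M lam T.+1 p nu)
    <= (1 - lam) * supnorm2 (fun p nu => V2 M lam p nu - V2T M lam T p nu).
Proof.
move=> /card_gt0P[k0 _] /card_gt0P[l0 _] /card_gt0P[a0 _] /card_gt0P[b0 _].
move=> /andP[lam0 lam1].
pose c := \sum_(x : K * L * (A * B)) `|M x.1.1 x.1.2 x.2.1 x.2.2|.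
have Mc k l a b : `|M k l a b| <= c.
  by rewrite /c (bigD1 ((k, l), (a, b))) //= lerDl sumr_ge0.
have c0 : 0 <= c by exact: sumr_ge0.
have rI := payoff_inf_regular lam0 lam1 c0 a0 b0 Mc.
have rT n := payoffT_regular lam0 lam1 c0 a0 b0 Mc n.
(* The infinite game is its own extension by one stage, so it serves as both [pay1] and [pay1']. *)
have pI : extends_by_stage M lam (payoff_inf M lam) (payoff_inf M lam).
  by move=> s t k l vs vt; exact: (payoff_inf_stage lam0 lam1 Mc k l c0 vs vt).
have pT : extends_by_stage M lam (payoffT M lam T) (payoffT M lam T.+1).
  by move=> s t k l _ _; exact: payoffTS.
split.
- exact: (dual1_supnorm_contract lam0 lam1 c0 k0 l0 a0 b0 rI rI (rT _) (rT _) pI pT).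
- exact: (dual2_supnorm_contract lam0 lam1 k0 l0 a0 b0 rI rI (rT _) (rT _) pI pT).
Qed.
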